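(* Let $\mu$ be a finite positive Borel measure on $[0,1)$. Then the following conditions are equivalent. (i) $\int_{[0,1)}\frac{d\mu(t)}{1-t}<\infty$. (ii) $\sum_{n=0}^\infty\mu_n<\infty$. (iii) The operator $I_\mu$ is a bounded operator from $H^\infty$ into itself. (iv) The operator $\mathcal{H}_\mu$ is a bounded operator from $H^\infty$ into itself.
   Context: $\mathbb{D}$ is the open unit disc in $\mathbb{C}$, and $H^\infty$ is the space of bounded analytic functions in $\mathbb{D}$ with the supremum norm. For a finite positive Borel measure $\mu$ on $[0,1)$ and $n=0,1,2,\dots$, let $\mu_n=\int_{[0,1)}t^n\,d\mu(t)$. For $f(z)=\sum_{k=0}^\infty a_kz^k$ analytic in $\mathbb{D}$, define $$\mathcal{H}_\mu(f)(z)=\sum_{n=0}^\infty\left(\sum_{k=0}^\infty \mu_{n+k}a_k\right)z^n,\qquad I_\mu(f)(z)=\int_{[0,1)}\frac{f(t)}{1-tz}\,d\mu(t),$$ each whenever the right hand side makes sense (the inner series converge for all $n$, respectively the integral converges for all $z\in\mathbb{D}$) and defines an analytic function in $\mathbb{D}$. Saying that one of these operators is bounded from $X$ into itself includes that it is well defined on every $f\in X$. *)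

(* Defs.v *)
From HB Require Import structures.
From mathcomp Require Export all_boot all_order all_algebra.
From mathcomp Require Export complex.
From mathcomp Require Export all_classical all_reals all_analysis.
Export Order.TTheory GRing.Theory Num.Theory.
Export numFieldNormedType.Exports.

Set Implicit Arguments.
Unset Strict Implicit.
Unset Printing Implicit Defensive.

Local Open Scope classical_set_scope.
Local Open Scope ring_scope.
Local Open Scope complex_scope.

Section Disc.
Context {R : realType}.
Local Notation C := R[i].

Definition unit_disc : set C := [set z | `|z| < 1].

(* The topology of the complex plane lives on the regular module [R[i]^o]. *)
Definition csum_to (u : nat -> C) (l : C) : Prop :=
  series (u : (R[i]^o)^nat) @ \oo --> (l : R[i]^o).

Definition has_pseries_on_ball
    (f : C -> C) (a : nat -> C) (c : C) (r : R) : Prop :=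
  forall z, `|z - c| < r%:C -> csum_to (fun k => a k * (z - c) ^+ k) (f z).

(* Functions on the disc are total functions on the plane, of which only the
   values in the disc are ever used. *)
Definition analytic_on_disc (f : C -> C) : Prop :=
  forall c, unit_disc c ->
    exists (a : nat -> C) (r : R), 0 < r /\ has_pseries_on_ball f a c r.

Definition Hinfty (f : C -> C) : Prop :=
  analytic_on_disc f /\
  exists M : R, forall z, unit_disc z -> `|f z| <= M%:C.

(* [`|w|] is an element of [R[i]] with zero imaginary part. *)
Definition Hinfty_norm (f : C -> C) : R :=
  sup [set complex.Re `|f z| | z in unit_disc].

(* A partially defined operator is given by its graph: [T f g] reads "[T] is
   defined at [f] and [T f = g] on the disc". *)
Definition bounded_on_Hinfty (T : (C -> C) -> (C -> C) -> Prop) : Prop :=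
  exists K : R, forall f, Hinfty f ->
    exists g, [/\ T f g, Hinfty g & Hinfty_norm g <= K * Hinfty_norm f].

End Disc.

Section Operators.
Context {R : realType}.
Local Notation C := R[i].
(* A finite Borel measure on [0, 1) is represented by a finite Borel measure on
   the line, which is only ever integrated over [0, 1). *)
Context (mu : {finite_measure set (measurableTypeR R) -> \bar R}).
Local Notation I01 := (`[0%R, 1%R[%classic : set (measurableTypeR R)).

Definition moment (n : nat) : R := \int[mu]_(t in I01) (t ^+ n).

Definition cintegrable01 (F : R -> C) : Prop :=
  mu.-integrable I01 (fun t => (complex.Re (F t))%:E) /\
  mu.-integrable I01 (fun t => (complex.Im (F t))%:E).

Definition cintegral01 (F : R -> C) : C :=
  (\int[mu]_(t in I01) complex.Re (F t)) +i*
  (\int[mu]_(t in I01) complex.Im (F t)).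

Definition hankel_op (f g : C -> C) : Prop :=
  exists a b : nat -> C,
    [/\ has_pseries_on_ball f a 0 1,
        forall n, csum_to (fun k => (moment (n + k))%:C * a k) (b n),
        has_pseries_on_ball g b 0 1
      & analytic_on_disc g].

Definition integral_op (f g : C -> C) : Prop :=
  let F z t := f t%:C / (1 - t%:C * z) in
  (forall z, unit_disc z -> cintegrable01 (F z) /\ g z = cintegral01 (F z)) /\
  analytic_on_disc g.

End Operators.

(* Main.v *)
Require Import Defs.
From mathcomp Require Import cyclic separable cyclotomic.
From mathcomp Require Import measurable_realfun ring lra.

(** By monotone convergence, integrating the geometric series of 1/(1 - t) term
    by term gives the sum of the moments, so the first two conditions say that
    the same number is finite ([sum_moments]).

    Assume this. Let f be bounded by M on the disc, with Taylor coefficients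
    a_k. The function g(z) = int f(t)/(1 - tz) dmu(t) is the sum on the disc of
    the power series with coefficients b_n = int t^n f(t) dmu(t): expanding
    1/(1 - tz) up to order n leaves the integral of (tz)^n f(t)/(1 - tz), which
    is O(|z|^n) ([pseries_cauchy_transform]). As |1 - tz| >= 1 - t, g is bounded
    by a multiple of M times int dmu(t)/(1 - t). Finally b_n is the sum over k
    of mu_(n+k) a_k: since |a_k| <= M, cutting the series of f at k = m costs at
    most M (1/(1 - t) - sum_(k < m) t^k), whose integral is M times the tail of
    the convergent series of the moments ([csum_to_complex_moment]). So both
    operators send f to g and are bounded ([operators_bounded]).

    Conversely, both operators can send the constant 1 only to the sum of
    mu_n z^n ([integral_op_one], [hankel_op_one]). If that function is bounded
    by K on the disc, every partial sum of the mu_n s^n with 0 < s < 1 is at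
    most K, and letting s tend to 1 bounds the partial sums of the moments
    ([summable_moments]).

    What is left is classical: analyticity is a local hypothesis, and the
    argument uses one Taylor series that represents f on the whole disc, with
    coefficients bounded by M ([bounded_analytic_taylor]). This is obtained
    without contour integrals.
    - Averaging the partial sums of a power series over the N-th roots of unity
      isolates one coefficient; this gives Cauchy's estimate on a circle inside
      the ball of convergence, and hence uniqueness of coefficients
      ([cauchy_estimate], [pseries_unique]).
    - A power series can be re-expanded at every point of its ball
      ([pseries_reexpand]).
    - Suppose that the series at 0 represents f on the ball of radius r and that
      f has an expansion of radius d at every point c of this ball. The k-th
      coefficient at c is the sum over m of C(m,k) a_m c^(m-k), and it is at
      most M / d'^k for d' < d. As a function of c this is again a power series;
      a second Cauchy estimate, now in c on the circle of radius s < r, gives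
      C(m,k) |a_m| s^(m-k) d'^k <= M. Summing over k with geometric weights
      bounds |a_m| (s + d1)^m for every d1 < d', so the series at 0 represents f
      on the ball of radius r + d ([pseries_extend]).
    - On a compact disc of radius less than 1 the local radii have a common
      lower bound ([analytic_uniform_radius]), so finitely many such steps
      reach any radius less than 1. *)

Set Implicit Arguments.
Unset Strict Implicit.
Unset Printing Implicit Defensive.

Local Open Scope classical_set_scope.
Local Open Scope ring_scope.
Local Open Scope complex_scope.

(** * The real-valued modulus *)

Section Modulus.
Context {R : realType}.
Implicit Types (x y : R) (z w : R[i]).

(** The norm of [R[i]] takes its values in [R[i]]; all estimates below are made
    on its real part, where the order is total. *)
Definition absC z : R := complex.Re `|z|.

Lemma absCE z : `|z| = (absC z)%:C.
Proof. by rewrite /absC RRe_real// ger0_real. Qed.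

Lemma absC_ge0 z : 0 <= absC z.
Proof. by rewrite -ler0c -absCE. Qed.

Lemma absC0 : absC 0 = 0.
Proof. by rewrite /absC normr0. Qed.

Lemma absC1 : absC 1 = 1.
Proof. by rewrite /absC normr1. Qed.

Lemma absCM z w : absC (z * w) = absC z * absC w.
Proof. by apply: complexI; rewrite rmorphM/= -!absCE normrM. Qed.

Lemma absCX z n : absC (z ^+ n) = absC z ^+ n.
Proof. by apply: complexI; rewrite rmorphXn/= -!absCE normrX. Qed.

Lemma absCV z : absC z^-1 = (absC z)^-1.
Proof. by apply: complexI; rewrite fmorphV/= -!absCE normfV. Qed.

Lemma absCN z : absC (- z) = absC z.
Proof. by rewrite /absC normrN. Qed.

Lemma absC_real x : absC x%:C = `|x|.
Proof. by rewrite /absC normc_def/= expr0n/= addr0 sqrtr_sqr. Qed.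

Lemma absC_nat n : absC n%:R = n%:R.
Proof. by rewrite -(rmorph_nat (real_complex R)) absC_real normr_nat. Qed.

Lemma absCD z w : absC (z + w) <= absC z + absC w.
Proof. by rewrite -lecR rmorphD/= -!absCE ler_normD. Qed.

Lemma absCB z w : absC (z - w) <= absC z + absC w.
Proof. by rewrite (le_trans (absCD _ _))// absCN. Qed.

Lemma absC_sum I (r : seq I) (P : pred I) (F : I -> R[i]) :
  absC (\sum_(i <- r | P i) F i) <= \sum_(i <- r | P i) absC (F i).
Proof.
elim/big_ind2 : _ => [|z u w v hz hw|//]; first by rewrite absC0.
by rewrite (le_trans (absCD _ _))// lerD.
Qed.

Lemma absC_eq0 z : absC z = 0 -> z = 0.
Proof. by move=> z0; apply/normr0_eq0; rewrite absCE z0. Qed.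

Lemma ler_Re z : `|complex.Re z| <= absC z.
Proof. by rewrite -lecR -absCE normc_ge_Re. Qed.

Lemma ler_Im z : `|complex.Im z| <= absC z.
Proof.
rewrite /absC normc_def/= -sqrtr_sqr ler_wsqrtr// lerDr sqr_ge0//.
Qed.

Lemma absC_le_ReIm z : absC z <= `|complex.Re z| + `|complex.Im z|.
Proof.
rewrite {1}(complexE z) (le_trans (absCD _ _))// absCM !absC_real lerD2l.
by rewrite {1}/absC normc_def/= expr0n/= add0r sqrtr_sqr normr1 mul1r.
Qed.

Lemma norm_ltE z x : (`|z| < x%:C) = (absC z < x).
Proof. by rewrite absCE ltcR. Qed.

Lemma norm_leE z x : (`|z| <= x%:C) = (absC z <= x).
Proof. by rewrite absCE lecR. Qed.

End Modulus.

(** * Series of complex numbers *)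

Section ComplexSeries.
Context {R : realType}.
Implicit Types (u v : nat -> R[i]) (l z w : R[i]) (b : nat -> R).

(** Moves convergence from the topology of [R[i]^o] to a real sequence of
    errors, so that only limits in the reals are handled afterwards. *)
Lemma csum_toP u l :
  csum_to u l <-> absC (l - \sum_(k < n) u k) @[n --> \oo] --> (0 : R).
Proof.
split.
  move/cvgrPdist_lt => h; apply/cvgrPdist_lt => e e0.
  have := h e%:C; rewrite ltcR => /(_ e0); apply: filterS => n.
  by rewrite /series/= big_mkord norm_ltE sub0r normrN ger0_norm ?absC_ge0.
move=> /cvgrPdist_lt h; apply/cvgrPdist_lt => e e0.
have eE : e = (complex.Re e)%:C by rewrite RRe_real// gtr0_real.
move: e0; rewrite {}eE ltcR => /h; apply: filterS => n.
by rewrite /series/= big_mkord norm_ltE sub0r normrN ger0_norm ?absC_ge0.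
Qed.

Lemma csum_to_squeeze u l (e : nat -> R) :
  (forall n, absC (l - \sum_(k < n) u k) <= e n) ->
  e n @[n --> \oo] --> (0 : R) -> csum_to u l.
Proof.
move=> le e0; apply/csum_toP; apply: squeeze_cvgr (cvg_cst 0) e0.
by apply: nearW => n; rewrite absC_ge0 le.
Qed.

Lemma csum_to_unique u l l' : csum_to u l -> csum_to u l' -> l = l'.
Proof. exact: cvg_unique. Qed.

Lemma csum_to_ext u v l : csum_to u l -> u =1 v -> csum_to v l.
Proof. by move=> ul /funext <-. Qed.

Lemma csum_toD u v l l' :
  csum_to u l -> csum_to v l' -> csum_to (fun k => u k + v k) (l + l').
Proof.
move=> /csum_toP ul /csum_toP vl; apply: csum_to_squeeze; last first.
  by rewrite -[X in _ --> X](addr0 0); apply: cvgD; [exact: ul|exact: vl].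
by move=> n; rewrite big_split/= opprD addrACA absCD.
Qed.

Lemma csum_toZ c u l : csum_to u l -> csum_to (fun k => c * u k) (c * l).
Proof.
move=> /csum_toP ul; apply: (@csum_to_squeeze _ _
    (fun n => absC c * absC (l - \sum_(k < n) u k))).
  by move=> n; rewrite -mulr_sumr -mulrBr absCM.
by rewrite -[X in _ --> X](mulr0 (absC c)); apply: cvgMr.
Qed.

Lemma csum_toB u v l l' :
  csum_to u l -> csum_to v l' -> csum_to (fun k => u k - v k) (l - l').
Proof.
move=> ul vl; rewrite -mulN1r.
by refine (csum_to_ext (csum_toD ul (csum_toZ (c := -1) vl)) _) => k; rewrite mulN1r.
Qed.

Lemma csum_to0 : csum_to (fun=> 0) (0 : R[i]).
Proof.
apply/csum_toP; under eq_fun do rewrite big1// subr0 absC0.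
exact: cvg_cst.
Qed.

Lemma csum_to_sum n (u : nat -> nat -> R[i]) (l : nat -> R[i]) :
  (forall i, csum_to (u i) (l i)) ->
  csum_to (fun k => \sum_(i < n) u i k) (\sum_(i < n) l i).
Proof.
move=> ul; elim: n => [|n IH].
  by under eq_fun do rewrite big_ord0; rewrite big_ord0; exact: csum_to0.
under eq_fun do rewrite big_ord_recr/=.
by rewrite big_ord_recr/=; apply: csum_toD.
Qed.

Lemma csum_to_finite u n :
  (forall k, (n <= k)%N -> u k = 0) -> csum_to u (\sum_(k < n) u k).
Proof.
move=> u0; apply/csum_toP; apply: cvg_near_cst; exists n => //= m /= nm.
rewrite -!(big_mkord xpredT) (big_cat_nat (leq0n n) nm) /=.
by rewrite opprD addrA subrr sub0r big_nat big1 ?oppr0 ?absC0// => k /andP[/u0].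
Qed.

Lemma csum_to_bounded u l : csum_to u l -> exists B, forall k, absC (u k) <= B.
Proof.
move=> ul.
have /cvg_seq_bounded [B [_ hB]] : cvgn (series (u : (R[i]^o)^nat)).
  by apply/cvg_ex; exists l.
have {}hB k : absC (series u k) <= complex.Re (B + 1).
  have := hB (B + 1); rewrite ltrDl ltr01 => /(_ isT k I)/= hk.
  by rewrite -norm_leE RRe_real// ger0_real// (le_trans _ hk).
exists (complex.Re (B + 1) + complex.Re (B + 1)) => k.
have -> : u k = series u k.+1 - series u k.
  by rewrite seriesEord/= big_ord_recr/= addrAC subrr add0r.
by rewrite (le_trans (absCB _ _))// lerD.
Qed.

Lemma partial_sum_le b V n : (forall k, 0 <= b k) ->
  series b n @[n --> \oo] --> V -> \sum_(k < n) b k <= V.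
Proof.
move=> b0 bV; have <- := cvg_lim (@Rhausdorff R) bV.
rewrite -[leLHS](big_mkord xpredT) -/(series b n).
apply: nondecreasing_cvgn_le; last by apply/cvg_ex; exists V.
by apply: nondecreasing_series => k _ _.
Qed.

(** The error of a partial sum is controlled by the tail of a real majorant. When
    the first [n] terms vanish, this bounds the whole sum by that tail. *)
Lemma csum_to_tail u l b V n : csum_to u l ->
  (forall k, absC (u k) <= b k) -> series b n @[n --> \oo] --> V ->
  absC (l - \sum_(k < n) u k) <= V - \sum_(k < n) b k.
Proof.
move=> /csum_toP ul ub bV; apply/ler_addgt0Pr => e e0.
have [N _ hN] := (cvgrPdist_lt _ _).1 ul e e0.
pose m := maxn N n.
have /hN : (N <= m)%N by rewrite leq_maxl.
rewrite /= sub0r normrN ger0_norm ?absC_ge0// => hm.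
have hb : \sum_(k < m) b k <= V.
  by apply: partial_sum_le bV => k; rewrite (le_trans _ (ub k))// absC_ge0.
have nm : (n <= m)%N by rewrite leq_maxr.
have -> : l - \sum_(k < n) u k =
   (\sum_(n <= k < m) u k) + (l - \sum_(k < m) u k).
  by rewrite -!(big_mkord xpredT) (big_cat_nat (leq0n n) nm) /=; ring.
apply: le_trans (absCD _ _) _; apply: lerD; last exact: ltW.
apply: le_trans (absC_sum _ _ _) _; apply: (@le_trans _ _ (\sum_(n <= k < m) b k)).
  by apply: ler_sum => k _.
by move: hb; rewrite -!(big_mkord xpredT) (big_cat_nat (leq0n n) nm) /= lerBrDl.
Qed.

Lemma csum_to_ReIm u x y :
  series (fun k => complex.Re (u k)) n @[n --> \oo] --> (x : R) ->
  series (fun k => complex.Im (u k)) n @[n --> \oo] --> (y : R) ->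
  csum_to u (x +i* y).
Proof.
move=> ux uy.
apply: (@csum_to_squeeze _ _ (fun n =>
    `|x - series (fun k => complex.Re (u k)) n| +
    `|y - series (fun k => complex.Im (u k)) n|)).
  move=> n; rewrite (le_trans (absC_le_ReIm _))//= !seriesEord/=.
  by rewrite !raddfB/= !raddf_sum.
have dist0 (v : nat -> R) (a : R) : v n @[n --> \oo] --> a -> `|a - v n| @[n --> \oo] --> (0 : R).
  by move=> va; rewrite -[X in _ --> X](normr0 R) -(subrr a);
    apply: cvg_norm; apply: cvgB; [exact: cvg_cst|exact: va].
by rewrite -[X in _ --> X](addr0 0); apply: cvgD; apply: dist0.
Qed.

(** Completeness is used through the real and imaginary parts, which converge
    absolutely. *)
Lemma csum_to_dominated u b : (forall k, absC (u k) <= b k) ->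
  cvgn (series b) -> exists l, csum_to u l.
Proof.
move=> ub cb.
have aux (p : R[i] -> R) : (forall z, `|p z| <= absC z) -> cvgn (series (p \o u)).
  move=> pz; apply: normed_cvg; apply: series_le_cvg cb => // k /=.
  - exact: normr_ge0.
  - exact: le_trans (absC_ge0 _) (ub k).
  - exact: le_trans (pz _) (ub k).
have /cvg_ex[x ux] := aux _ (@ler_Re R).
have /cvg_ex[y uy] := aux _ (@ler_Im R).
by exists (x +i* y); apply: csum_to_ReIm.
Qed.

End ComplexSeries.

(** * Cauchy's estimate for power series *)

Section PowerSeries.
Context {R : realType}.
Implicit Types (f : R[i] -> R[i]) (a b : nat -> R[i]) (c z w : R[i]).

(** Bounded terms at radius [t] give absolute convergence at every smaller radius,
    by comparison with the geometric series of ratio [s / t]. *)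
Lemma cvgn_geometric_dominated (A : nat -> R) (s t B : R) :
  (forall k, 0 <= A k) -> 0 <= s -> s < t ->
  (forall k, A k * t ^+ k <= B) -> cvgn (series (fun k => A k * s ^+ k)).
Proof.
move=> A0 s0 st AB.
have t0 : 0 < t by rewrite (le_lt_trans s0).
have st1 : `|s / t| < 1.
  by rewrite ger0_norm ?divr_ge0 ?(ltW t0)// ltr_pdivrMr// mul1r.
apply: (series_le_cvg (v_ := geometric B (s / t))).
- by move=> k; rewrite mulr_ge0// exprn_ge0.
- move=> k; rewrite /= mulr_ge0 ?exprn_ge0 ?divr_ge0 ?(ltW t0)//.
  by rewrite (le_trans _ (AB k))// mulr_ge0// exprn_ge0// ltW.
- move=> k; rewrite /= expr_div_n mulrCA [leLHS]mulrC ler_wpM2l ?exprn_ge0//.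
  by rewrite ler_pdivlMr ?exprn_gt0.
- exact: is_cvg_geometric_series.
Qed.

Lemma has_pseries_ball_le f a c r r' :
  r' <= r -> has_pseries_on_ball f a c r -> has_pseries_on_ball f a c r'.
Proof.
by move=> rr' fa z zr; apply: fa; apply: lt_le_trans zr _; rewrite lecR.
Qed.

Lemma pseries_summable f a c r s : has_pseries_on_ball f a c r ->
  0 <= s -> s < r -> cvgn (series (fun k => absC (a k) * s ^+ k)).
Proof.
move=> fa s0 sr; have [t0 st tr] : [/\ 0 <= (s + r) / 2, s < (s + r) / 2 & (s + r) / 2 < r].
  by split; lra.
have /fa/csum_to_bounded[B hB] : `|(c + ((s + r) / 2)%:C) - c| < r%:C.
  by rewrite addrAC subrr add0r norm_ltE absC_real ger0_norm.
apply: (@cvgn_geometric_dominated _ s ((s + r) / 2) B) => // k.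
  exact: absC_ge0.
by have := hB k; rewrite absCM absCX addrAC subrr add0r absC_real ger0_norm.
Qed.

(** ['X^N - 1] splits over the algebraically closed field [R[i]] and is separable
    in characteristic zero, so its [N] distinct roots form a cyclic group. *)
Lemma primitive_root_exists N : (0 < N)%N ->
  exists w : R[i], N.-primitive_root w.
Proof.
move=> N0; pose p : {poly R[i]} := 'X^N - 1.
have [r Dp] := closed_field_poly_normal p.
have {}Dp : p = \prod_(z <- r) ('X - z%:P).
  by rewrite Dp (monicP _) ?scale1r// monicXnsubC.
have r1 : all N.-unity_root r.
  by apply/allP => z zr; rewrite /root_of_unity -/p Dp root_prod_XsubC.
have ur : uniq r.
  by rewrite -separable_prod_XsubC -Dp separable_Xn_sub_1// pnatr_eq0 -lt0n.
have sr : (N <= size r)%N.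
  by rewrite -ltnS -(size_prod_XsubC r id) -Dp size_XnsubC.
by have /hasP[w _] := has_prim_root N0 r1 ur sr; exists w.
Qed.

Lemma absC_root1 N w : (0 < N)%N -> w ^+ N = 1 -> absC w = 1.
Proof.
move=> N0 w1; have : absC w ^+ N = 1 by rewrite -absCX w1 absC1.
by move/eqP; rewrite pexpr_eq1 ?absC_ge0// => /eqP.
Qed.

(** Averaging [w ^- k * p(w)] over the points [w = s * zeta ^+ j], with [zeta] a
    primitive [N]-th root of unity, kills every monomial of degree less than [N]
    except the one of degree [k]. *)
Lemma poly_coef_le N a s B k :
  (forall w, absC w = s -> absC (\sum_(m < N) a m * w ^+ m) <= B) ->
  0 <= s -> (k < N)%N -> absC (a k) * s ^+ k <= B.
Proof.
move=> hB s0 kN; have N0 : (0 < N)%N by case: N kN {hB}.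
have [w wN] := primitive_root_exists N0.
have w1 : absC w = 1 by apply: absC_root1 N0 (prim_expr_order wN).
have orth m : (m < N)%N ->
    \sum_(j < N) (w ^+ (m + (N - k))) ^+ j = (if m == k then N%:R else 0).
  move=> mN; case: eqP => [->|mk].
    rewrite subnKC ?(ltnW kN)// prim_expr_order//.
    by rewrite (eq_bigr (fun=> 1)) ?sumr_const ?card_ord// => j _; rewrite expr1n.
  have w_neq1 : w ^+ (m + (N - k)) - 1 != 0.
    rewrite subr_eq0 -(prim_order_dvd wN); apply/negP => d.
    apply: mk; apply/eqP; rewrite -(modn_small mN) -(modn_small kN) -/(_ = _ %[mod N]).
    rewrite -(eqn_modDr (N - k)) subnKC ?(ltnW kN)// modnn.
    exact: d.
  apply: (mulfI w_neq1); rewrite -subrX1 mulr0 -exprM mulnC exprM.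
  by rewrite (prim_expr_order wN) expr1n subrr.
(* [w ^+ (N - k)] is the inverse of [w ^+ k]. *)
have key : \sum_(j < N) (w ^+ (N - k)) ^+ j *
    (\sum_(m < N) a m * (s%:C * w ^+ j) ^+ m) = N%:R * (a k * s%:C ^+ k).
  under eq_bigr do rewrite mulr_sumr; rewrite exchange_big/=.
  rewrite (bigD1 (Ordinal kN))//= [X in _ + X]big1 ?addr0.
    have := orth _ kN; rewrite eqxx => <-.
    rewrite mulr_suml; apply: eq_bigr => j _.
    by rewrite exprMn exprD exprMn -!exprM (mulnC k j); ring.
  move=> m /eqP mk.
  under eq_bigr => j _.
    rewrite (_ : _ * _ = a m * s%:C ^+ m * (w ^+ (m + (N - k))) ^+ j); last first.
      by rewrite exprMn exprD exprMn -!exprM (mulnC m j); ring.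
    over.
  rewrite -mulr_sumr orth//; case: eqP => [km|]; last by rewrite mulr0.
  by case: mk; apply: val_inj.
have : absC (N%:R * (a k * s%:C ^+ k)) <= N%:R * B.
  rewrite -key (le_trans (absC_sum _ _ _))//.
  rewrite -[N in leRHS]card_ord mulr_natl -sumr_const; apply: ler_sum => j _.
  rewrite absCM !absCX w1 !expr1n mul1r; apply: hB.
  by rewrite absCM absCX w1 expr1n mulr1 absC_real ger0_norm.
by rewrite !absCM absC_nat absCX absC_real ger0_norm// ler_pM2l// ltr0n.
Qed.

(** Far partial sums are uniformly close to [f] on the circle of radius [s], so
    the bound for polynomials applies to them with [M + e] in place of [M]. *)
Lemma cauchy_estimate f a c r s M k : has_pseries_on_ball f a c r ->
  0 <= s -> s < r -> (forall z, absC (z - c) = s -> absC (f z) <= M) ->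
  absC (a k) * s ^+ k <= M.
Proof.
move=> fa s0 sr fM.
have /cvg_ex[V sV] := pseries_summable fa s0 sr.
apply/ler_addgt0Pr => e e0.
have [N _ /(_ (maxn N k.+1))] := (cvgrPdist_lt _ _).1 sV e e0.
rewrite /= leq_maxl => /(_ isT) hN.
apply: (@poly_coef_le (maxn N k.+1)) => //; last by rewrite leq_maxr.
move=> w ws; pose z := c + w.
have zw : z - c = w by rewrite /z addrAC subrr add0r.
have := fa z; rewrite zw norm_ltE ws => /(_ sr) fz.
have ub j : absC (a j * w ^+ j) <= absC (a j) * s ^+ j by rewrite absCM absCX ws.
have tail := csum_to_tail (maxn N k.+1) fz ub sV.
set S := \sum_(_ < _) _ in tail *.
have -> : S = f z - (f z - S) by ring.
apply: le_trans (absCB _ _) _; apply: lerD; first by apply: fM; rewrite zw.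
apply: le_trans tail _; apply/ltW; apply: le_lt_trans hN.
by rewrite seriesEord/= ler_norm.
Qed.

(** The difference of two expansions represents the zero function, to which
    Cauchy's estimate applies with bound zero. *)
Lemma pseries_unique f a b c r : 0 < r ->
  has_pseries_on_ball f a c r -> has_pseries_on_ball f b c r -> a =1 b.
Proof.
move=> r0 fa fb k.
have h0 : has_pseries_on_ball (fun=> 0) (fun k => a k - b k) c r.
  move=> z zr; rewrite -(subrr (f z)).
  refine (csum_to_ext (csum_toB (fa z zr) (fb z zr)) _) => j.
  by rewrite mulrBl.
have r20 : 0 < r / 2 by lra.
have := @cauchy_estimate _ _ c r (r / 2) 0 k h0 (ltW r20).
have rr : r / 2 < r by lra.
move=> /(_ rr); rewrite absC0 => /(_ (fun _ _ => lexx _)).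
rewrite pmulr_lle0 ?exprn_gt0// => ab0.
by apply/subr0_eq/absC_eq0/le_anti; rewrite ab0 absC_ge0.
Qed.

End PowerSeries.

(** * Change of centre *)

Section Reexpansion.
Context {R : realType}.
Implicit Types (f : R[i] -> R[i]) (a b : nat -> R[i]) (c z w : R[i]).

Lemma cvg_partial_tail (b : nat -> R) (V : R) :
  series b n @[n --> \oo] --> V ->
  V - \sum_(k < n) b k @[n --> \oo] --> (0 : R).
Proof.
move=> bV; rewrite -[X in _ --> X](subrr V); apply: cvgB; first exact: cvg_cst.
by under eq_fun do rewrite -(big_mkord xpredT).
Qed.

Lemma binomial_weight_le (x y : R) m k : 0 <= x -> 0 <= y -> (k <= m)%N ->
  'C(m, k)%:R * x ^+ (m - k) * y ^+ k <= (x + y) ^+ m.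
Proof.
move=> x0 y0 km; rewrite exprDn (bigD1 (Ordinal (km : (k < m.+1)%N)))//=.
rewrite -mulrA mulr_natl lerDl sumr_ge0// => i _.
by rewrite mulrn_wge0// mulr_ge0// exprn_ge0.
Qed.

(** Write [h = c' - c] and [w = z - c']. The sum of [b k * w ^+ k] over [k < n] is
    the sum over [m] of the part of [a m * (h + w) ^+ m] with exponent of [w] less
    than [n]. This differs from [a m * (h + w) ^+ m] only for [m >= n], and by at
    most [absC (a m) * (absC h + absC w) ^+ m]. So the error is the tail of one
    convergent series, and no double series has to be rearranged.

    The formula for the coefficients is part of the conclusion because
    [pseries_coef_binomial_le] reads it as a power series in [c']. *)
Lemma pseries_reexpand f a c c' r : has_pseries_on_ball f a c r ->
  absC (c' - c) < r ->
  exists b, (forall k, csum_to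
               (fun m => 'C(m, k)%:R * a m * (c' - c) ^+ (m - k)) (b k)) /\
            has_pseries_on_ball f b c' (r - absC (c' - c)).
Proof.
move=> fa; set h := c' - c => hr.
have h0 := absC_ge0 h.
have [b hb] : {b & forall k,
    csum_to (fun m => 'C(m, k)%:R * a m * h ^+ (m - k)) (b k)}.
  apply: (@choice _ _ (fun k l => csum_to (fun m => 'C(m, k)%:R * a m * h ^+ (m - k)) l)) => k.
  pose d := (r - absC h) / 2.
  have d0 : 0 < d by rewrite /d; lra.
  have hd0 : 0 <= absC h + d by rewrite addr_ge0// ltW.
  have hd : absC h + d < r by rewrite /d; lra.
  have cs : cvgn (series (fun m => d ^- k * (absC (a m) * (absC h + d) ^+ m))).
    by apply: is_cvg_seriesZ; exact: pseries_summable fa hd0 hd.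
  apply: csum_to_dominated cs => m /=.
  rewrite ler_pdivlMl ?exprn_gt0// !absCM absCX absC_nat.
  rewrite [leLHS](_ : _ =
    absC (a m) * ('C(m, k)%:R * absC h ^+ (m - k) * d ^+ k)); last by ring.
  rewrite ler_wpM2l ?absC_ge0//.
  have [mk|km] := ltnP m k.
    by rewrite bin_small// !mul0r exprn_ge0.
  by rewrite binomial_weight_le// ltW.
exists b; split=> // z; rewrite norm_ltE; set w := z - c' => wr.
have w0 := absC_ge0 w.
have hw0 : 0 <= absC h + absC w by rewrite addr_ge0.
have hw : absC h + absC w < r by lra.
have zc : z - c = h + w by rewrite /h /w; ring.
have := fa z; rewrite zc norm_ltE (le_lt_trans (absCD _ _) hw) => /(_ isT) fz.
have /cvg_ex[V sV] := pseries_summable fa hw0 hw.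
apply: (csum_to_squeeze _ (cvg_partial_tail sV)) => n.
(* [g m] lists the terms of the binomial expansion of [a m * (h + w) ^+ m]. *)
pose g m k := 'C(m, k)%:R * a m * h ^+ (m - k) * w ^+ k.
have gE m : a m * (h + w) ^+ m = \sum_(k < m.+1) g m k.
  rewrite exprDn mulr_sumr; apply: eq_bigr => k _.
  by rewrite /g -mulr_natl; ring.
have g0 m k : (m < k)%N -> g m k = 0 by move=> mk; rewrite /g bin_small// !mul0r.
have partial : csum_to (fun m => \sum_(k < n) g m k) (\sum_(k < n) b k * w ^+ k).
  apply: (csum_to_sum (u := fun k m => g m k) (l := fun k => b k * w ^+ k)) => k.
  rewrite mulrC; refine (csum_to_ext (csum_toZ (c := w ^+ k) (hb k)) _) => m.
  by rewrite /g mulrC.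
have absg m : \sum_(k < m.+1) absC (g m k) = absC (a m) * (absC h + absC w) ^+ m.
  rewrite exprDn mulr_sumr; apply: eq_bigr => k _.
  by rewrite /g -[X in _ = _ * X]mulr_natl !absCM !absCX absC_nat; ring.
have diff := csum_toB fz partial.
have diff_small m : (m < n)%N -> a m * (h + w) ^+ m - \sum_(k < n) g m k = 0.
  move=> mn; rewrite gE -!(big_mkord xpredT) (big_cat_nat (leq0n m.+1) mn)/=.
  by rewrite opprD addrA subrr sub0r big_nat big1 ?oppr0// => k /andP[/g0].
have diff_le m : absC (a m * (h + w) ^+ m - \sum_(k < n) g m k) <=
    absC (a m) * (absC h + absC w) ^+ m.
  have [/diff_small ->|nm] := ltnP m n.
    by rewrite absC0 mulr_ge0 ?absC_ge0// exprn_ge0.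
  rewrite gE -absg -!(big_mkord xpredT) -(big_mkord xpredT (fun k => absC (g m k))).
  rewrite (big_cat_nat (leq0n n) (leqW nm))/= addrAC subrr add0r.
  rewrite (big_cat_nat (leq0n n) (leqW nm))/=.
  rewrite (le_trans (absC_sum _ _ _))// lerDr sumr_ge0// => k _.
  exact: absC_ge0.
have := csum_to_tail n diff diff_le sV.
by rewrite [X in _ - X]big1 ?subr0// => k _; apply: diff_small.
Qed.

Lemma pseries_unit_disc_analytic f a : has_pseries_on_ball f a 0 1 ->
  analytic_on_disc f.
Proof.
move=> fa c; rewrite /unit_disc/= -[1]/(1%:C) norm_ltE -{1}(subr0 c) => c1.
have [b [_ fb]] := pseries_reexpand fa c1.
by exists b, (1 - absC (c - 0)); rewrite subr_gt0.
Qed.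

End Reexpansion.

(** * The Taylor series of a bounded analytic function *)

Section Continuation.
Context {R : realType}.
Implicit Types (f : R[i] -> R[i]) (a b : nat -> R[i]) (c z w : R[i]).

Lemma geometric_partial_le (q : R) n : 0 <= q -> q < 1 ->
  \sum_(k < n) q ^+ k <= (1 - q)^-1.
Proof.
move=> q0 q1; have := @cvg_geometric_series R 1 q.
rewrite ger0_norm// => /(_ q1); rewrite div1r => cg.
have g0 k : 0 <= geometric 1 q k by rewrite /= mul1r exprn_ge0.
apply: le_trans (partial_sum_le n g0 cg).
by apply: ler_sum => k _; rewrite /= mul1r.
Qed.

(** Cauchy's estimate used twice. At a point [c] it bounds the [k]-th local
    coefficient by [M / d' ^+ k]. By [pseries_reexpand] and uniqueness, this
    coefficient times [c ^+ k] is the power series in [c] with coefficients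
    ['C(m, k) * a m], and the second estimate is made on the circle of radius [s]
    in the variable [c]. *)
Lemma pseries_coef_binomial_le f a r d s d' M m k :
  has_pseries_on_ball f a 0 r ->
  (forall z, absC z < r + d -> absC (f z) <= M) ->
  (forall c, absC c < r -> exists b, has_pseries_on_ball f b c d) ->
  0 < s -> s < r -> 0 < d' -> d' < d -> (k <= m)%N ->
  'C(m, k)%:R * absC (a m) * s ^+ (m - k) * d' ^+ k <= M.
Proof.
move=> fa fM floc s0 sr d'0 d'd km.
have [F hF] : {F : R[i] -> R[i] & forall c, absC c < r ->
    csum_to (fun m => 'C(m, k)%:R * a m * c ^+ (m - k)) (F c) /\
    absC (F c) * d' ^+ k <= M}.
  apply: (@choice _ _ (fun c l => absC c < r ->
    csum_to (fun m => 'C(m, k)%:R * a m * c ^+ (m - k)) l /\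
    absC l * d' ^+ k <= M)) => c.
  have [cr|cr] := boolP (absC c < r); last by exists 0.
  have [b fb] := floc c cr; exists (b k) => _; split; last first.
    refine (cauchy_estimate k fb (ltW d'0) d'd _) => z zc; apply: fM.
    by rewrite -(subrK c z) (le_lt_trans (absCD _ _))// zc; lra.
  have := pseries_reexpand fa; move/(_ c); rewrite subr0 => /(_ cr)[b' [hb' fb']].
  have e0 : 0 < Num.min d (r - absC c).
    by rewrite lt_min (lt_trans d'0 d'd)/= subr_gt0.
  have -> : b k = b' k; last exact: hb'.
  apply: (pseries_unique e0).
    by apply: has_pseries_ball_le fb; rewrite ge_min lexx.
  by apply: has_pseries_ball_le fb'; rewrite ge_min lexx orbT.
have hG : has_pseries_on_ball (fun c => c ^+ k * F c)
    (fun m => 'C(m, k)%:R * a m) 0 r.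
  move=> z; rewrite norm_ltE subr0 => zr.
  refine (csum_to_ext (csum_toZ (c := z ^+ k) (hF z zr).1) _) => j.
  have [jk|kj] := ltnP j k; first by rewrite bin_small// !mul0r mulr0.
  by rewrite mulrCA -exprD subnKC.
have := @cauchy_estimate R _ _ 0 r s (s ^+ k * (M / d' ^+ k)) m hG (ltW s0) sr.
have -> : absC ('C(m, k)%:R * a m) * s ^+ m =
    s ^+ k * ('C(m, k)%:R * absC (a m) * s ^+ (m - k)).
  by rewrite absCM absC_nat -[X in s ^+ X](subnKC km) exprD; ring.
rewrite ler_pM2l ?exprn_gt0// ler_pdivlMr ?exprn_gt0//; apply.
move=> z; rewrite subr0 => zs; rewrite absCM absCX zs.
rewrite ler_pM2l ?exprn_gt0// ler_pdivlMr ?exprn_gt0//.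
by have [|//] := hF z; rewrite zs.
Qed.

(** The bounds of [pseries_coef_binomial_le] make the series at 0 converge on the
    larger ball, to some [g]. A point [z] of the new annulus lies within [d] of a
    point [c] of the old ball on the same ray. The expansions of [f] and [g] at
    [c] have the same coefficients, given by the same series in [a], so [f] and
    [g] agree at [z]. *)
Lemma pseries_extend f a r d M : 0 < r -> 0 < d ->
  has_pseries_on_ball f a 0 r ->
  (forall z, absC z < r + d -> absC (f z) <= M) ->
  (forall c, absC c < r -> exists b, has_pseries_on_ball f b c d) ->
  has_pseries_on_ball f a 0 (r + d).
Proof.
move=> r0 d0 fa fM floc.
have summable x : 0 <= x -> x < r + d ->
    cvgn (series (fun m => absC (a m) * x ^+ m)).
  move=> x0 xrd.
  (* A point at distance [x] from 0 lies within [d1] of the circle of radius [s],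
     and [d2] leaves room for geometric weights of ratio [d1 / d2]. *)
  have [s [s0 sr xs]] : exists s, [/\ 0 < s, s < r & x - d < s].
    exists ((Num.max 0 (x - d) + r) / 2).
    have m0 : 0 <= Num.max 0 (x - d) by rewrite le_max lexx.
    have m1 : x - d <= Num.max 0 (x - d) by rewrite le_max lexx orbT.
    have m2 : Num.max 0 (x - d) < r by rewrite gt_max r0/=; lra.
    by split; lra.
  have [d1 [d10 d1d xd1]] : exists d1, [/\ 0 < d1, d1 < d & x - s < d1].
    exists ((Num.max 0 (x - s) + d) / 2).
    have m0 : 0 <= Num.max 0 (x - s) by rewrite le_max lexx.
    have m1 : x - s <= Num.max 0 (x - s) by rewrite le_max lexx orbT.
    have m2 : Num.max 0 (x - s) < d by rewrite gt_max d0/=; lra.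
    by split; lra.
  pose d2 := (d1 + d) / 2.
  have [d20 d12 d2d] : [/\ 0 < d2, d1 < d2 & d2 < d] by rewrite /d2; split; lra.
  pose q := d1 / d2.
  have q0 : 0 <= q by rewrite divr_ge0// ltW.
  have q1 : q < 1 by rewrite ltr_pdivrMr// mul1r.
  have M0 : 0 <= M by rewrite (le_trans (absC_ge0 (f 0)))// fM// absC0 addr_gt0.
  apply: (@cvgn_geometric_dominated _ _ x (s + d1) (M * (1 - q)^-1)) => //.
  - by move=> k; exact: absC_ge0.
  - by lra.
  move=> m; rewrite exprDn mulr_sumr.
  apply: (@le_trans _ _ (\sum_(k < m.+1) M * q ^+ k)); last first.
    by rewrite -mulr_sumr ler_wpM2l// geometric_partial_le.
  apply: ler_sum => k _; rewrite -mulr_natr.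
  have km : (k <= m)%N := ltn_ord k.
  have binle := pseries_coef_binomial_le fa fM floc s0 sr d20 d2d km.
  rewrite [leLHS](_ : _ =
    'C(m, k)%:R * absC (a m) * s ^+ (m - k) * d2 ^+ k * q ^+ k); last first.
    have qk : d2 ^+ k * q ^+ k = d1 ^+ k.
      by rewrite -exprMn mulrC divfK// gt_eqF.
    by rewrite -[RHS]mulrA qk; ring.
  by rewrite ler_wpM2r// exprn_ge0.
have [g hg] : {g : R[i] -> R[i] & has_pseries_on_ball g a 0 (r + d)}.
  apply: (@choice _ _ (fun z l => `|z - 0| < (r + d)%:C ->
    csum_to (fun k => a k * (z - 0) ^+ k) l)) => z.
  rewrite norm_ltE subr0; have [zr|zr] := boolP (absC z < r + d); last by exists 0.
  have [l hl] : exists l, csum_to (fun k => a k * z ^+ k) l.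
    apply: csum_to_dominated (summable _ (absC_ge0 z) zr) => k.
    by rewrite absCM absCX.
  by exists l.
move=> z zrd; have -> : f z = g z; last exact: hg.
move: zrd; rewrite norm_ltE subr0 => zrd.
have [zr|rz] := ltP (absC z) r.
  have := fa z; rewrite norm_ltE subr0 => /(_ zr) h1.
  by have := hg z; rewrite norm_ltE subr0 => /(_ zrd); apply: csum_to_unique.
have z0 : 0 < absC z by rewrite (lt_le_trans r0).
have [s [s0 sr zs]] : exists s, [/\ 0 < s, s < r & absC z - d < s].
  exists ((Num.max 0 (absC z - d) + r) / 2).
  have m0 : 0 <= Num.max 0 (absC z - d) by rewrite le_max lexx.
  have m1 : absC z - d <= Num.max 0 (absC z - d) by rewrite le_max lexx orbT.
  have m2 : Num.max 0 (absC z - d) < r by rewrite gt_max r0/=; lra.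
  by split; lra.
pose c := (s / absC z)%:C * z.
have cs : absC c = s.
  by rewrite absCM absC_real ger0_norm ?divr_ge0 ?ltW// mulfVK// gt_eqF.
have zc : absC (z - c) < d.
  have -> : z - c = (1 - s / absC z)%:C * z by rewrite /c rmorphB/=; ring.
  rewrite absCM absC_real ger0_norm.
    by rewrite mulrBl mul1r mulfVK ?gt_eqF//; lra.
  by rewrite subr_ge0 ler_pdivrMr// mul1r ltW// (lt_le_trans sr).
have [|b fb] := floc c; first by rewrite cs.
have := pseries_reexpand fa; move/(_ c); rewrite subr0 cs => /(_ sr)[b1 [hb1 fb1]].
have := pseries_reexpand hg; move/(_ c); rewrite subr0 cs.
have srd : s < r + d by lra.
move=> /(_ srd)[b2 [hb2 gb2]].
have e0 : 0 < Num.min d (r - s) by rewrite lt_min d0/= subr_gt0.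
have bb1 : b =1 b1.
  apply: (pseries_unique e0).
    by apply: has_pseries_ball_le fb; rewrite ge_min lexx.
  by apply: has_pseries_ball_le fb1; rewrite ge_min lexx orbT.
have bb2 : b = b2.
  by apply/funext => k; rewrite bb1; exact: csum_to_unique (hb1 k) (hb2 k).
have := fb z; rewrite norm_ltE => /(_ zc); rewrite bb2 => h1.
have := gb2 z; rewrite norm_ltE => h2; apply: csum_to_unique h1 (h2 _); lra.
Qed.

(** By re-expansion, a radius of convergence at one point gives half this radius
    at all nearby points. So the local radius is locally bounded below, and the
    square with vertices [+-1 +- i], which contains the disc, is compact. *)
Lemma analytic_uniform_radius f rho : analytic_on_disc f -> rho < 1 ->
  exists2 d, 0 < d &
    forall c, absC c <= rho -> exists b, has_pseries_on_ball f b c d.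
Proof.
move=> fan rho1.
pose C (p : R * R) : R[i] := p.1 +i* p.2.
have loc (p : R * R) : exists2 e, 0 < e & forall p', absC (C p' - C p) < e ->
    absC (C p') <= rho -> exists b, has_pseries_on_ball f b (C p') e.
  have [prho|prho] := leP (absC (C p)) rho.
    have [|b [r [r0 fb]]] := fan (C p).
      by rewrite /unit_disc/= -[1]/(1%:C) norm_ltE (le_lt_trans prho).
    exists (r / 2); first by rewrite divr_gt0.
    move=> p' pp' _; have pr : absC (C p' - C p) < r by lra.
    have [b' [_ fb']] := pseries_reexpand fb pr.
    by exists b'; apply: has_pseries_ball_le fb'; lra.
  (* No point this close to [p] lies in the disc of radius [rho]. *)
  exists (absC (C p) - rho); first by rewrite subr_gt0.
  move=> p' pp' p'rho; exfalso.
  have : absC (C p) <= absC (C p') + absC (C p' - C p).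
    by have := absCB (C p') (C p' - C p); rewrite opprB addrCA subrr addr0.
  by lra.
have : compact (`[(-1)%R : R, 1] `*` `[(-1)%R : R, 1]).
  by apply: compact_setX; exact: segment_compact.
move/compact_near_coveringP => /(_ R (0 : R)^'+ (fun d p =>
  absC (C p) <= rho -> exists b, has_pseries_on_ball f b (C p) d)).
have cov (x : R * R) : \forall x' \near x & d \near (0 : R)^'+,
    absC (C x') <= rho -> exists b, has_pseries_on_ball f b (C x') d.
  have [e e0 he] := loc x.
  exists (ball x (e / 2), [set d | d < e]).
    split; first by apply: nbhsx_ballx; rewrite divr_gt0.
    exact: nbhs_right_lt.
  move=> [x' d] [/= xx' de] x'rho.
  have [|b fb] := he x' _ x'rho.
    apply: le_lt_trans (absC_le_ReIm _) _; rewrite /C/=.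
    case: xx' => /=; rewrite /ball/= distrC => h1; rewrite distrC => h2; lra.
  by exists b; apply: has_pseries_ball_le fb; exact: ltW.
move=> /(_ _ (fun x _ => cov x)) near0.
have [d [d0 hd]] := filter_ex (filterI (nbhs_right_gt (0 : R)) near0).
exists d => // c crho; have := hd (complex.Re c, complex.Im c).
rewrite /C/=.
have -> : complex.Re c +i* complex.Im c = c by case: c {crho}.
apply => //; split; rewrite /= in_itv/= -ler_norml.
  by rewrite (le_trans (ler_Re c))// (le_trans crho)// ltW.
by rewrite (le_trans (ler_Im c))// (le_trans crho)// ltW.
Qed.

Lemma le_at_left1 (g : R -> R) M : {for 1, continuous g} ->
  (forall s, 0 < s -> s < 1 -> g s <= M) -> g 1 <= M.
Proof.
move=> g1 gM; rewrite leNgt; apply/negP => Mg.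
have h : \forall x \near (1 : R)^'-, M < g x.
  exact: (cvgr_gt _ (cvg_at_left_filter g1) _ Mg).
have [x [[x1 x0] Mx]] := filter_ex (filterI (filterI
   (nbhs_left_lt (1 : R)) (nbhs_left_gt (ltr01 : 0 < 1 :> R))) h).
by have := gM x x0 x1; rewrite leNgt Mx.
Qed.

(** Below radius [rho] each step of [pseries_extend] enlarges the ball by the fixed
    amount [e]; capping the radius at [rho] keeps every step inside the region
    where [e] is a valid local radius. The bound on the coefficients is Cauchy's
    estimate on circles whose radius tends to 1. *)
Lemma bounded_analytic_taylor f M : analytic_on_disc f ->
  (forall z, unit_disc z -> absC (f z) <= M) ->
  exists a, has_pseries_on_ball f a 0 1 /\ forall k, absC (a k) <= M.
Proof.
move=> fan fM.
have fM' z : absC z < 1 -> absC (f z) <= M.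
  by move=> z1; apply: fM; rewrite /unit_disc/= -[1]/(1%:C) norm_ltE.
have [|a [r0 [r00 fa0]]] := fan 0; first by rewrite /unit_disc/= normr0.
have global rho : 0 < rho -> rho < 1 -> has_pseries_on_ball f a 0 rho.
  move=> rho0 rho1; have [d d0 hd] := analytic_uniform_radius fan rho1.
  pose e := Num.min d (1 - rho).
  have e0 : 0 < e by rewrite lt_min d0 subr_gt0.
  have ed : e <= d by rewrite ge_min lexx.
  have e1 : e <= 1 - rho by rewrite ge_min lexx orbT.
  have grow n : has_pseries_on_ball f a 0 (Num.min rho (r0 + n%:R * e)).
    elim: n => [|n IH].
      by apply: has_pseries_ball_le fa0; rewrite mul0r addr0 ge_min lexx orbT.
    set r := Num.min _ _ in IH.
    have r_gt0 : 0 < r.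
      by rewrite lt_min rho0/= ltr_pwDl// mulr_ge0// ltW.
    have r_le : r <= rho by rewrite ge_min lexx.
    apply: (@has_pseries_ball_le _ _ _ _ (r + e)).
      rewrite /r; have [h|h] := leP rho (r0 + n%:R * e).
        by rewrite (@le_trans _ _ rho)// ?ge_min ?lexx// lerDl ltW.
      by rewrite -addrA -{3}(mul1r e) -mulrDl natr1 ge_min lexx orbT.
    apply: (@pseries_extend _ _ _ _ M) => // [z ze|c cr].
      by apply: fM'; lra.
    have [|b fb] := hd c; first by rewrite ltW// (lt_le_trans cr).
    by exists b; apply: has_pseries_ball_le fb.
  have := grow (Num.bound (rho / e)); rewrite min_l//.
  have /archi_boundP : 0 <= rho / e by rewrite divr_ge0// ltW.
  by rewrite ltr_pdivrMr// => h; lra.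
have fa : has_pseries_on_ball f a 0 1.
  move=> z; rewrite norm_ltE subr0 => z1.
  have z0 := absC_ge0 z.
  have := global ((absC z + 1) / 2).
  have -> : 0 < (absC z + 1) / 2 by lra.
  have -> : (absC z + 1) / 2 < 1 by lra.
  move=> /(_ isT isT z); rewrite norm_ltE subr0; apply; lra.
exists a; split=> // k.
have := @le_at_left1 (fun s => absC (a k) * s ^+ k) M.
rewrite expr1n mulr1; apply.
  apply: cvgM; first exact: cvg_cst.
  exact: exprn_continuous.
move=> s s0 s1; refine (cauchy_estimate k fa (ltW s0) s1 _) => z.
by rewrite subr0 => zs; apply: fM'; rewrite zs.
Qed.

End Continuation.

(** * Complex integrals and moments *)

Section Integration.
Context {R : realType} (mu : {finite_measure set (measurableTypeR R) -> \bar R}).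
Local Notation I01 := (`[0%R, 1%R[%classic : set (measurableTypeR R)).
Implicit Types (F G : R -> R[i]) (h : R -> R) (z c : R[i]) (f : R[i] -> R[i]).

Lemma measurable_I01 : measurable I01.
Proof. exact: measurable_itv. Qed.
Local Hint Resolve measurable_I01 : core.

Definition cmeasurable01 F :=
  measurable_fun I01 (fun t => complex.Re (F t)) /\
  measurable_fun I01 (fun t => complex.Im (F t)).

Lemma Re_mul (z w : R[i]) :
  complex.Re (z * w) = complex.Re z * complex.Re w - complex.Im z * complex.Im w.
Proof. by case: z => a b; case: w. Qed.

Lemma Im_mul (z w : R[i]) :
  complex.Im (z * w) = complex.Re z * complex.Im w + complex.Im z * complex.Re w.
Proof. by case: z => a b; case: w. Qed.

Lemma cmeasurableM F G : cmeasurable01 F -> cmeasurable01 G ->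
  cmeasurable01 (fun t => F t * G t).
Proof.
move=> [FR FI] [GR GI]; split.
  apply: (eq_measurable_fun (fun t => complex.Re (F t) * complex.Re (G t) -
    complex.Im (F t) * complex.Im (G t))).
    by move=> t _; rewrite Re_mul.
  by apply: measurable_funB; apply: measurable_funM.
apply: (eq_measurable_fun (fun t => complex.Re (F t) * complex.Im (G t) +
  complex.Im (F t) * complex.Re (G t))).
  by move=> t _; rewrite Im_mul.
by apply: measurable_funD; apply: measurable_funM.
Qed.

Lemma cmeasurable_real h : measurable_fun I01 h ->
  cmeasurable01 (fun t => (h t)%:C).
Proof. by move=> mh; split=> //=; exact: measurable_cst. Qed.

Lemma cmeasurable_cst c : cmeasurable01 (fun=> c).
Proof. by split; exact: measurable_cst. Qed.

Lemma csum_to_Re (u : nat -> R[i]) l : csum_to u l ->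
  series (fun k => complex.Re (u k)) n @[n --> \oo] --> complex.Re l.
Proof.
move=> /csum_toP/cvgrPdist_le ul; apply/cvgrPdist_le => e e0.
have := ul e e0; apply: filterS => n.
rewrite sub0r normrN ger0_norm ?absC_ge0//; apply: le_trans.
by apply: le_trans (ler_Re _); rewrite seriesEord/= raddfB/= [in leRHS]raddf_sum.
Qed.

Lemma csum_to_Im (u : nat -> R[i]) l : csum_to u l ->
  series (fun k => complex.Im (u k)) n @[n --> \oo] --> complex.Im l.
Proof.
move=> /csum_toP/cvgrPdist_le ul; apply/cvgrPdist_le => e e0.
have := ul e e0; apply: filterS => n.
rewrite sub0r normrN ger0_norm ?absC_ge0//; apply: le_trans.
by apply: le_trans (ler_Im _); rewrite seriesEord/= raddfB/= [in leRHS]raddf_sum.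
Qed.

(** Every integrand below is a product of sums of power series in [t], so this
    replaces any appeal to continuity of analytic functions. *)
Lemma cmeasurable_csum (u : nat -> R -> R[i]) F :
  (forall k, cmeasurable01 (u k)) ->
  (forall t, I01 t -> csum_to (u^~ t) (F t)) -> cmeasurable01 F.
Proof.
move=> mu_ uF; split.
  apply: (@measurable_fun_cvg _ _ _ _
    (fun n t => series (fun k => complex.Re (u k t)) n)).
    by move=> n; apply: measurable_sum => k; have [] := mu_ k.
  by move=> t /uF /csum_to_Re.
apply: (@measurable_fun_cvg _ _ _ _
  (fun n t => series (fun k => complex.Im (u k t)) n)).
  by move=> n; apply: measurable_sum => k; have [] := mu_ k.
by move=> t /uF /csum_to_Im.
Qed.

Lemma unit_discE z : unit_disc z = (absC z < 1) :> Prop.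
Proof. by rewrite /unit_disc/= -[1]/(1%:C) norm_ltE. Qed.

Lemma I01E t : I01 t -> 0 <= t /\ t < 1.
Proof. by rewrite /= in_itv/= => /andP. Qed.

Lemma absC_I01 t : I01 t -> absC t%:C = t.
Proof. by move=> /I01E[t0 _]; rewrite absC_real ger0_norm. Qed.

Lemma I01_disc t : I01 t -> unit_disc t%:C.
Proof. by move=> It; rewrite unit_discE absC_I01//; have [] := I01E It. Qed.

Lemma cmeasurable_pseries f a : has_pseries_on_ball f a 0 1 ->
  cmeasurable01 (fun t => f t%:C).
Proof.
move=> fa; apply: (@cmeasurable_csum (fun k t => a k * t%:C ^+ k)).
  move=> k; apply: cmeasurableM; first exact: cmeasurable_cst.
  under eq_fun do rewrite -rmorphXn/=.
  by apply: cmeasurable_real; exact: exprn_measurable.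
move=> t /I01_disc; rewrite unit_discE => t1.
by have := fa t%:C; rewrite subr0 norm_ltE; apply.
Qed.

Lemma csum_to_geometric z : absC z < 1 ->
  csum_to (fun k => z ^+ k) ((1 - z)^-1).
Proof.
move=> z1; have nz : 1 - z != 0.
  by apply/eqP => /subr0_eq zE; move: z1; rewrite -zE absC1 ltxx.
apply: (@csum_to_squeeze _ _ _ (fun n => absC ((1 - z)^-1) * absC z ^+ n)).
  move=> n; rewrite le_eqVlt; apply/orP; left; apply/eqP.
  rewrite -absCX -absCM; congr absC; apply: (mulfI nz).
  rewrite mulrBr mulfV// mulrA mulfV// mul1r.
  by rewrite -[1 - z]opprB mulNr -subrX1 opprB subKr.
rewrite -[X in _ --> X](mulr0 (absC (1 - z)^-1)); apply: cvgMr.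
by apply: cvg_expr; rewrite ger0_norm ?absC_ge0.
Qed.

(** At [z = 1] this is an expansion of the real kernel [(1 - t)^-1]. *)
Lemma pseries_cauchy_kernel z : absC z <= 1 ->
  has_pseries_on_ball (fun w => (1 - w * z)^-1) (fun k => z ^+ k) 0 1.
Proof.
move=> z1 w; rewrite norm_ltE subr0 => w1.
have wz : absC (w * z) < 1.
  by rewrite absCM (le_lt_trans _ w1)// ler_piMr ?absC_ge0.
refine (csum_to_ext (csum_to_geometric wz) _) => k.
by rewrite exprMn mulrC.
Qed.

Lemma cmeasurable_kernel z : absC z <= 1 ->
  cmeasurable01 (fun t => (1 - t%:C * z)^-1).
Proof. by move=> /pseries_cauchy_kernel/cmeasurable_pseries. Qed.

Lemma measurable_kernel1 : measurable_fun I01 (fun t => (1 - t)^-1).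
Proof.
have [|+ _] := @cmeasurable_kernel 1; first by rewrite absC1.
apply: eq_measurable_fun => t _.
by rewrite mulr1 -(rmorph1 (real_complex R)) -rmorphB -fmorphV.
Qed.

(** Both bounds come from [1 <= absC (1 - t z) + t * absC z]. *)
Lemma absC_kernel_le z t : I01 t -> absC z < 1 ->
  absC ((1 - t%:C * z)^-1) <= (1 - t)^-1 /\
  absC ((1 - t%:C * z)^-1) <= (1 - absC z)^-1.
Proof.
move=> It z1; have [t0 t1] := I01E It; have z0 := absC_ge0 z.
have : 1 <= absC (1 - t%:C * z) + t * absC z.
  by have := absCD (1 - t%:C * z) (t%:C * z); rewrite subrK absC1 absCM absC_I01.
have tz1 : t * absC z <= t by rewrite ler_piMr// ltW.
have tz2 : t * absC z <= absC z by rewrite ler_piMl// ltW.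
by move=> h; rewrite absCV; split; rewrite lef_pV2 ?posrE; lra.
Qed.

Lemma cintegrable_dominated F h : cmeasurable01 F ->
  (forall t, I01 t -> absC (F t) <= h t) ->
  mu.-integrable I01 (EFin \o h) -> cintegrable01 mu F.
Proof.
move=> [FR FI] Fh ih; split; apply: (le_integrable measurable_I01 _ _ ih).
- exact/measurable_EFinP.
- move=> t It; rewrite /= lee_fin (le_trans (ler_Re _))//.
  by rewrite (le_trans (Fh _ It))// ler_norm.
- exact/measurable_EFinP.
- move=> t It; rewrite /= lee_fin (le_trans (ler_Im _))//.
  by rewrite (le_trans (Fh _ It))// ler_norm.
Qed.

Lemma cintegrable_bounded F M : cmeasurable01 F ->
  (forall t, I01 t -> absC (F t) <= M) -> cintegrable01 mu F.
Proof.
move=> mF FM; apply: (cintegrable_dominated mF FM).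
exact: finite_measure_integrable_cst.
Qed.

(** The constant 2 comes from bounding the real and imaginary parts separately;
    boundedness of an operator is insensitive to it. *)
Lemma absC_cintegral_le F h : cintegrable01 mu F ->
  (forall t, I01 t -> absC (F t) <= h t) ->
  mu.-integrable I01 (EFin \o h) ->
  absC (cintegral01 mu F) <= 2 * \int[mu]_(t in I01) h t.
Proof.
move=> [FR FI] Fh ih; rewrite (le_trans (absC_le_ReIm _))//= mulr_natl mulr2n.
apply: lerD.
  rewrite (le_trans (le_normr_Rintegral _ _))//; apply: le_Rintegral => //.
    exact: integrable_norm.
  by move=> t It; rewrite (le_trans (ler_Re _))// Fh.
rewrite (le_trans (le_normr_Rintegral _ _))//; apply: le_Rintegral => //.
  exact: integrable_norm.
by move=> t It; rewrite (le_trans (ler_Im _))// Fh.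
Qed.

Lemma cintegrableB F G : cintegrable01 mu F -> cintegrable01 mu G ->
  cintegrable01 mu (fun t => F t - G t).
Proof.
move=> [FR FI] [GR GI]; split.
  apply: (eq_integrable measurable_I01 _ _ _ (integrableB measurable_I01 FR GR)) => t _.
  by rewrite -EFinB -raddfB.
apply: (eq_integrable measurable_I01 _ _ _ (integrableB measurable_I01 FI GI)) => t _.
by rewrite -EFinB -raddfB.
Qed.

Lemma cintegralB F G : cintegrable01 mu F -> cintegrable01 mu G ->
  cintegral01 mu (fun t => F t - G t) = cintegral01 mu F - cintegral01 mu G.
Proof.
move=> [FR FI] [GR GI]; rewrite /cintegral01; apply/eqP; rewrite eq_complex/=.
under eq_Rintegral do rewrite raddfB/=.
under [X in _ && (X == _)]eq_Rintegral do rewrite raddfB/=.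
by rewrite !RintegralB// !eqxx.
Qed.

Lemma cintegralZ c F : cintegrable01 mu F ->
  cintegral01 mu (fun t => c * F t) = c * cintegral01 mu F.
Proof.
move=> [FR FI]; rewrite /cintegral01; apply/eqP; rewrite eq_complex.
rewrite Re_mul Im_mul/=.
under eq_Rintegral do rewrite Re_mul.
under [X in _ && (X == _)]eq_Rintegral do rewrite Im_mul.
have iZ (x : R) h : mu.-integrable I01 (EFin \o h) ->
    mu.-integrable I01 (EFin \o (fun t => x * h t)).
  by move=> ih; exact: (integrableZl measurable_I01 x ih).
rewrite RintegralB//; [|exact: iZ|exact: iZ].
rewrite RintegralD//; [|exact: iZ|exact: iZ].
by rewrite !RintegralZl// !eqxx.
Qed.

Lemma eq_cintegral F G : (forall t, I01 t -> F t = G t) ->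
  cintegral01 mu F = cintegral01 mu G.
Proof.
move=> FG; rewrite /cintegral01.
by congr (_ +i* _); apply: eq_Rintegral => t; rewrite inE => /FG ->.
Qed.

Lemma integrable_pow n : mu.-integrable I01 (EFin \o (fun t => t ^+ n)).
Proof.
apply: (le_integrable measurable_I01 _ _ (finite_measure_integrable_cst mu 1 measurable_I01)).
  by apply/measurable_EFinP; exact: exprn_measurable.
move=> t /I01E[t0 t1]; rewrite /= lee_fin normr1 ger0_norm ?exprn_ge0//.
by rewrite exprn_ile1// ltW.
Qed.

Lemma moment_ge0 n : 0 <= moment mu n.
Proof. by apply: Rintegral_ge0 => t /I01E[t0 _]; rewrite exprn_ge0. Qed.

Lemma cintegral_pow n : cintegral01 mu (fun t => t%:C ^+ n) = (moment mu n)%:C.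
Proof.
rewrite /cintegral01 /moment; congr (_ +i* _).
  by apply: eq_Rintegral => t _; rewrite -rmorphXn.
under eq_Rintegral do rewrite -rmorphXn/=.
by rewrite Rintegral_cst// mul0r.
Qed.

Lemma cvg_series_EFin (u : nat -> R) (l : R) :
  (\sum_(0 <= i < n) (u i)%:E)%E @[n --> \oo] --> l%:E <->
  series u n @[n --> \oo] --> l.
Proof.
have -> : (fun n => (\sum_(0 <= i < n) (u i)%:E)%E) = EFin \o series u.
  by apply/funext => n; rewrite sumEFin.
split=> [/fine_cvgP[_]//|ul].
by apply: cvg_EFin; [exact: nearW|exact: ul].
Qed.

Lemma sum_moments : (\sum_(0 <= n <oo) (moment mu n)%:E =
  \int[mu]_(t in I01) ((1 - t)^-1)%:E)%E.
Proof.
have mE n : (moment mu n)%:E = (\int[mu]_(t in I01) (t ^+ n)%:E)%E.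
  by rewrite /moment /Rintegral fineK// integrable_fin_num// integrable_pow.
under eq_eseriesr do rewrite mE.
rewrite -integral_nneseries//.
- apply: eq_integral => t; rewrite inE => /I01E[t0 t1].
  apply/cvg_lim => //; apply/cvg_series_EFin; rewrite -div1r.
  have -> : series (fun n => t ^+ n) = series (geometric 1 t).
    by apply/funext => n; apply: eq_bigr => k _; rewrite /= mul1r.
  by apply: cvg_geometric_series; rewrite ger0_norm.
- by move=> n; apply/measurable_EFinP; exact: exprn_measurable.
- by move=> n t /I01E[t0 _]; rewrite lee_fin exprn_ge0.
Qed.

Lemma integrable_kernel1 :
  (\int[mu]_(t in I01) ((1 - t)^-1)%:E < +oo)%E ->
  mu.-integrable I01 (EFin \o (fun t => (1 - t)^-1)).
Proof.
move=> fin; apply/integrableP; split.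
  by apply/measurable_EFinP; exact: measurable_kernel1.
congr (_ < _)%E: fin; apply: eq_integral => t; rewrite inE => /I01E[t0 t1].
by rewrite /= ger0_norm// invr_ge0 subr_ge0 ltW.
Qed.

Lemma series_moments : mu.-integrable I01 (EFin \o (fun t => (1 - t)^-1)) ->
  series (moment mu) n @[n --> \oo] --> \int[mu]_(t in I01) (1 - t)^-1.
Proof.
move=> ik; apply/cvg_series_EFin.
rewrite /Rintegral fineK; last exact: integrable_fin_num.
rewrite -sum_moments; apply: is_cvg_nneseries => n _ _.
by rewrite lee_fin moment_ge0.
Qed.

End Integration.

(** * The norm of bounded analytic functions *)

Section HinftyNorm.
Context {R : realType}.
Implicit Types (f : R[i] -> R[i]) (z : R[i]).

Lemma Hinfty_norm_ge f z : Hinfty f -> unit_disc z -> absC (f z) <= Hinfty_norm f.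
Proof.
move=> [_ [M fM]] z1; apply: ub_le_sup; last by exists z.
by exists M => _ [w w1 <-]; rewrite -/(absC _) -norm_leE fM.
Qed.

Lemma Hinfty_norm_le f M : (forall z, unit_disc z -> absC (f z) <= M) ->
  Hinfty_norm f <= M.
Proof.
move=> fM; apply: ge_sup.
  by exists (absC (f 0)), 0; rewrite ?unit_discE ?absC0.
by move=> _ [w w1 <-]; exact: fM.
Qed.

Lemma pseries_one :
  has_pseries_on_ball (fun=> 1 : R[i]) (fun k => (k == 0)%:R) 0 1.
Proof.
move=> z _.
have := @csum_to_finite R (fun k => (k == 0)%:R * (z - 0) ^+ k) 1.
rewrite big_ord1 expr0 mulr1; apply => -[//|k _].
by rewrite mul0r.
Qed.

Lemma Hinfty_one : Hinfty (fun=> 1 : R[i]).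
Proof.
split; first exact: pseries_unit_disc_analytic pseries_one.
by exists 1 => z _; rewrite norm_leE absC1.
Qed.

End HinftyNorm.

(** * The two operators *)

Section Operators.
Context {R : realType} (mu : {finite_measure set (measurableTypeR R) -> \bar R}).
Local Notation I01 := (`[0%R, 1%R[%classic : set (measurableTypeR R)).
Implicit Types (f g : R[i] -> R[i]) (a b : nat -> R[i]) (z : R[i]).
Local Hint Resolve measurable_I01 : core.

Definition cauchy_integrand f z (t : R) := f t%:C / (1 - t%:C * z).
Definition cauchy_transform f z := cintegral01 mu (cauchy_integrand f z).
Definition complex_moment f n := cintegral01 mu (fun t => t%:C ^+ n * f t%:C).

Lemma cmeasurable_pow n : cmeasurable01 (fun t : R => t%:C ^+ n).
Proof.
apply: (@cmeasurable_csum _ (fun k t => if k == 0 then (t ^+ n)%:C else 0)).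
  case=> [|k] /=; last exact: cmeasurable_cst.
  by apply: cmeasurable_real; exact: exprn_measurable.
move=> t _; have := @csum_to_finite R (fun k => if k == 0 then (t ^+ n)%:C else 0) 1.
by rewrite big_ord1 /= -rmorphXn; apply => -[].
Qed.

Section BoundedFunction.
Context (f : R[i] -> R[i]) (a : nat -> R[i]) (M : R).
Context (fa : has_pseries_on_ball f a 0 1).
Context (fM : forall z, unit_disc z -> absC (f z) <= M).

Lemma cmeasurable_cauchy_integrand z : absC z < 1 ->
  cmeasurable01 (cauchy_integrand f z).
Proof.
move=> z1; apply: cmeasurableM; first exact: cmeasurable_pseries fa.
exact: cmeasurable_kernel (ltW z1).
Qed.

Lemma absC_cauchy_integrand_le z t : I01 t -> absC z < 1 ->
  absC (cauchy_integrand f z t) <= M * (1 - t)^-1 /\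
  absC (cauchy_integrand f z t) <= M * (1 - absC z)^-1.
Proof.
move=> It z1; have [h1 h2] := absC_kernel_le It z1.
by split; rewrite absCM ler_pM ?absC_ge0// fM//; exact: I01_disc.
Qed.

Lemma absC_pow_le1 n t : I01 t -> absC (t%:C ^+ n) <= 1.
Proof.
move=> It; have [t0 t1] := I01E It.
by rewrite absCX absC_I01// exprn_ile1// ltW.
Qed.

Lemma cintegrable_cauchy_integrand z : absC z < 1 ->
  cintegrable01 mu (cauchy_integrand f z).
Proof.
move=> z1; apply: (@cintegrable_bounded _ _ _ (M * (1 - absC z)^-1)).
  exact: cmeasurable_cauchy_integrand.
by move=> t It; have [] := absC_cauchy_integrand_le It z1.
Qed.

Lemma cintegrable_pow_mul n :
  cintegrable01 mu (fun t => t%:C ^+ n * f t%:C).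
Proof.
apply: (@cintegrable_bounded _ _ _ M).
  by apply: cmeasurableM; [exact: cmeasurable_pow|exact: cmeasurable_pseries fa].
move=> t It; rewrite absCM -[leRHS]mul1r ler_pM ?absC_ge0 ?absC_pow_le1// fM//.
exact: I01_disc.
Qed.

(** The partial sums are exact up to the integral of
    [(t z) ^+ n * f(t) / (1 - t z)], which decays like [absC z ^+ n] because the
    measure is finite. *)
Lemma pseries_cauchy_transform :
  has_pseries_on_ball (cauchy_transform f) (complex_moment f) 0 1.
Proof.
move=> z; rewrite norm_ltE subr0 => z1; have z0 := absC_ge0 z.
pose rem n t := (t%:C * z) ^+ n * cauchy_integrand f z t.
have rem_le n t : I01 t -> absC (rem n t) <= absC z ^+ n * (M * (1 - absC z)^-1).
  move=> It; rewrite absCM ler_pM ?absC_ge0//; last first.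
    by have [] := absC_cauchy_integrand_le It z1.
  rewrite exprMn absCM -[leRHS]mul1r ler_pM ?absC_ge0 ?absC_pow_le1//.
  by rewrite absCX.
have rem_int n : cintegrable01 mu (rem n).
  apply: (cintegrable_bounded mu _ (rem_le n)).
  apply: cmeasurableM; last exact: cmeasurable_cauchy_integrand.
  by under eq_fun do rewrite exprMn;
    apply: cmeasurableM; [exact: cmeasurable_pow|exact: cmeasurable_cst].
have partial n : cauchy_transform f z - \sum_(k < n) complex_moment f k * z ^+ k =
    cintegral01 mu (rem n).
  elim: n => [|n IH].
    by rewrite big_ord0 subr0; apply: eq_cintegral => t _; rewrite /rem expr0 mul1r.
  rewrite big_ord_recr/= opprD addrA IH mulrC /complex_moment -cintegralZ; last first.
    exact: cintegrable_pow_mul.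
  rewrite -cintegralB//; last first.
    apply: (@cintegrable_bounded _ _ _ (absC z ^+ n * M)).
      apply: cmeasurableM; first exact: cmeasurable_cst.
      by apply: cmeasurableM; [exact: cmeasurable_pow|exact: cmeasurable_pseries fa].
    move=> t It; rewrite absCM absCX ler_wpM2l ?exprn_ge0//.
    rewrite absCM -[leRHS]mul1r ler_pM ?absC_ge0 ?absC_pow_le1// fM//.
    exact: I01_disc.
  apply: eq_cintegral => t It; rewrite /rem /cauchy_integrand.
  have nz : 1 - t%:C * z != 0.
    apply/eqP => /subr0_eq tz; have := absC_I01 It; have [t0 t1] := I01E It.
    have : absC (t%:C * z) < 1.
      by rewrite absCM absC_I01// (le_lt_trans _ z1)// ler_piMl// ltW.
    by rewrite -tz absC1 ltxx.
  by rewrite exprS !exprMn; field.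
apply: (@csum_to_squeeze _ _ _ (fun n =>
   (2 * (M * (1 - absC z)^-1 * fine (mu I01))) * absC z ^+ n)).
  move=> n; rewrite partial.
  rewrite (le_trans (absC_cintegral_le (rem_int n) (rem_le n) _))//.
    exact: finite_measure_integrable_cst.
  by rewrite Rintegral_cst// le_eqVlt; apply/orP; left; apply/eqP; ring.
rewrite -[X in _ --> X](mulr0 (2 * (M * (1 - absC z)^-1 * fine (mu I01)))).
by apply: cvgMr; apply: cvg_expr; rewrite ger0_norm.
Qed.

Context (kernel_int : mu.-integrable I01 (EFin \o (fun t => (1 - t)^-1))).

Lemma absC_cauchy_transform_le z : absC z < 1 ->
  absC (cauchy_transform f z) <= 2 * (M * \int[mu]_(t in I01) (1 - t)^-1).
Proof.
move=> z1.
have ik : mu.-integrable I01 (EFin \o (fun t => M * (1 - t)^-1)).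
  exact: (integrableZl _ M kernel_int).
have le t : I01 t -> absC (cauchy_integrand f z t) <= M * (1 - t)^-1.
  by move=> It; have [] := absC_cauchy_integrand_le It z1.
rewrite (le_trans (absC_cintegral_le (cintegrable_cauchy_integrand z1) le ik))//.
by rewrite RintegralZl.
Qed.

Context (aM : forall k, absC (a k) <= M).

(** Replacing [f] by its partial sum of order [m] under the integral costs
    [t ^+ n] times a Taylor tail, at most [M] times the tail of [(1 - t)^-1]. The
    integral of the latter tends to zero because the moments sum to the integral
    of [(1 - t)^-1]. *)
Lemma csum_to_complex_moment n :
  csum_to (fun k => (moment mu (n + k))%:C * a k) (complex_moment f n).
Proof.
pose J := \int[mu]_(t in I01) (1 - t)^-1.
pose rem m t := t%:C ^+ n * f t%:C - \sum_(k < m) t%:C ^+ (n + k) * a k.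
pose tail m t := M * ((1 - t)^-1 - \sum_(k < m) t ^+ k).
have rem_le m t : I01 t -> absC (rem m t) <= tail m t.
  move=> It; have [t0 t1] := I01E It.
  have -> : rem m t = t%:C ^+ n * (f t%:C - \sum_(k < m) a k * t%:C ^+ k).
    rewrite mulrBr mulr_sumr; congr (_ - _); apply: eq_bigr => k _.
    by rewrite exprD; ring.
  rewrite absCM -[leRHS]mul1r ler_pM ?absC_ge0 ?absC_pow_le1//.
  have ft : csum_to (fun k => a k * t%:C ^+ k) (f t%:C).
    by have := @fa t%:C; rewrite subr0 norm_ltE absC_I01//; apply.
  have ub k : absC (a k * t%:C ^+ k) <= M * t ^+ k.
    by rewrite absCM absCX absC_I01// ler_wpM2r// exprn_ge0.
  have geo : series (fun k => M * t ^+ k) m @[m --> \oo] --> M * (1 - t)^-1.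
    by apply: cvg_geometric_series; rewrite ger0_norm.
  by rewrite (le_trans (csum_to_tail m ft ub geo))// -mulr_sumr -mulrBr.
have tail_int m : mu.-integrable I01 (EFin \o (tail m)) /\
    \int[mu]_(t in I01) tail m t = M * (J - \sum_(k < m) moment mu k).
  have [i1 e1] : mu.-integrable I01 (EFin \o (fun t => (1 - t)^-1 - \sum_(k < m) t ^+ k)) /\
      \int[mu]_(t in I01) ((1 - t)^-1 - \sum_(k < m) t ^+ k) =
      J - \sum_(k < m) moment mu k.
    elim: m => [|m [IH1 IH2]].
      have E t : (1 - t)^-1 - \sum_(k < 0) t ^+ k = (1 - t)^-1 :> R.
        by rewrite big_ord0 subr0.
      rewrite big_ord0 subr0 /J; split; last by apply: eq_Rintegral => t _; rewrite E.
      by apply: eq_integrable kernel_int => // t _; rewrite /= E.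
    have E t : (1 - t)^-1 - \sum_(k < m.+1) t ^+ k =
        ((1 - t)^-1 - \sum_(k < m) t ^+ k) - t ^+ m :> R.
      by rewrite big_ord_recr/= opprD addrA.
    split.
      apply: (eq_integrable measurable_I01 _ _ _
        (integrableB measurable_I01 IH1 (integrable_pow mu m))).
      by move=> t _; rewrite /= E.
    under eq_Rintegral do rewrite E.
    rewrite RintegralB//; last exact: integrable_pow.
    by rewrite IH2 big_ord_recr/= opprD addrA.
  split; first exact: (integrableZl _ M i1).
  by rewrite /tail RintegralZl// e1.
have pow_int m k : cintegrable01 mu (fun t => a k * t%:C ^+ m).
  apply: (@cintegrable_bounded _ _ _ (absC (a k))).
    by apply: cmeasurableM; [exact: cmeasurable_cst|exact: cmeasurable_pow].
  by move=> t It; rewrite absCM ler_piMr ?absC_ge0 ?absC_pow_le1.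
have rem_int m : cintegrable01 mu (rem m) /\
    cintegral01 mu (rem m) =
    complex_moment f n - \sum_(k < m) (moment mu (n + k))%:C * a k.
  have powE k : cintegral01 mu (fun t => a k * t%:C ^+ (n + k)) =
      (moment mu (n + k))%:C * a k.
    have ip : cintegrable01 mu (fun t => t%:C ^+ (n + k)).
      apply: (@cintegrable_bounded _ _ _ 1); first exact: cmeasurable_pow.
      by move=> t It; exact: absC_pow_le1.
    by rewrite (cintegralZ (a k) ip) (cintegral_pow mu) mulrC.
  elim: m => [|m [IH1 IH2]].
    have E t : rem 0 t = t%:C ^+ n * f t%:C by rewrite /rem big_ord0 subr0.
    rewrite big_ord0 subr0; split; last by apply: eq_cintegral.
    rewrite (_ : rem 0 = fun t => t%:C ^+ n * f t%:C); last exact: funext.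
    exact: cintegrable_pow_mul.
  have E t : rem m.+1 t = rem m t - a m * t%:C ^+ (n + m).
    by rewrite /rem big_ord_recr/= opprD addrA [t%:C ^+ (n + m) * _]mulrC.
  rewrite (_ : rem m.+1 = fun t => rem m t - a m * t%:C ^+ (n + m));
    last exact: funext.
  split; last by rewrite cintegralB// IH2 powE big_ord_recr/= opprD addrA.
  exact: cintegrableB.
apply: (@csum_to_squeeze _ _ _ (fun m => 2 * (M * (J - \sum_(k < m) moment mu k)))).
  move=> m; have [i1 e1] := rem_int m; have [i2 e2] := tail_int m.
  by rewrite -e1 (le_trans (absC_cintegral_le i1 (rem_le m) i2))// e2.
rewrite -[X in _ --> X](mulr0 2) -[X in _ * X](mulr0 M).
by do 2! apply: cvgMr; apply: cvg_partial_tail; exact: series_moments.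
Qed.

End BoundedFunction.

Lemma operators_bounded : mu.-integrable I01 (EFin \o (fun t => (1 - t)^-1)) ->
  exists K : R, forall f, Hinfty f -> exists g,
    [/\ integral_op mu f g, hankel_op mu f g, Hinfty g &
        Hinfty_norm g <= K * Hinfty_norm f].
Proof.
move=> ik; pose J := \int[mu]_(t in I01) (1 - t)^-1.
exists (2 * J) => f Hf; have fM z := Hinfty_norm_ge (z := z) Hf.
have [a [fa aM]] := bounded_analytic_taylor Hf.1 fM.
have ga := pseries_cauchy_transform fa fM.
have gan := pseries_unit_disc_analytic ga.
have gle z : unit_disc z ->
    absC (cauchy_transform f z) <= 2 * J * Hinfty_norm f.
  rewrite unit_discE => z1.
  by rewrite (le_trans (absC_cauchy_transform_le fa fM ik z1))// -mulrA (mulrC J).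
exists (cauchy_transform f); split.
- split=> // z; rewrite unit_discE => z1; split=> //.
  exact: (cintegrable_cauchy_integrand fa fM z1).
- exists a, (complex_moment f); split=> // n.
  exact: (csum_to_complex_moment fa fM ik aM).
- by split=> //; exists (2 * J * Hinfty_norm f) => z /gle; rewrite norm_leE.
- exact: Hinfty_norm_le.
Qed.

(** The moments are nonnegative, so at a real point [s] of the disc each partial
    sum is at most the value of [g], hence at most [K]; then [s] tends to 1. *)
Lemma summable_moments g K :
  has_pseries_on_ball g (fun n => (moment mu n)%:C) 0 1 ->
  (forall z, unit_disc z -> absC (g z) <= K) ->
  (\sum_(0 <= n <oo) (moment mu n)%:E < +oo)%E.
Proof.
move=> gm gK.
have partial N : \sum_(k < N) moment mu k <= K.
  pose p := \poly_(k < N) moment mu k.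
  have -> : \sum_(k < N) moment mu k = p.[1].
    by rewrite horner_poly; apply: eq_bigr => k _; rewrite expr1n mulr1.
  apply: le_at_left1; first exact: continuous_horner.
  move=> s s0 s1; rewrite horner_poly.
  have s1' : absC s%:C < 1 by rewrite absC_real ger0_norm// ltW.
  have := gm s%:C; rewrite subr0 norm_ltE => /(_ s1')/csum_to_Re gs.
  have gsE : series (fun k => moment mu k * s ^+ k) n @[n --> \oo] --> complex.Re (g s%:C).
    have -> : (fun k => moment mu k * s ^+ k) =
        fun k => complex.Re ((moment mu k)%:C * s%:C ^+ k); last exact: gs.
      by apply: funext => k; rewrite -rmorphXn -rmorphM.
  rewrite (le_trans (partial_sum_le N _ gsE))//.
    by move=> k; rewrite mulr_ge0 ?moment_ge0// exprn_ge0// ltW.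
  rewrite (le_trans (ler_norm _))// (le_trans (ler_Re _))// gK//.
  by rewrite unit_discE.
apply: (@le_lt_trans _ _ K%:E); last exact: ltry.
apply: lime_le; first by apply: is_cvg_nneseries => n _ _; rewrite lee_fin moment_ge0.
by apply: nearW => N; rewrite sumEFin lee_fin big_mkord.
Qed.

(** The two operators enter the converse direction only through the image of the
    constant 1, whose power series is the generating function of the moments. *)
Lemma integral_op_one g : integral_op mu (fun=> 1) g ->
  has_pseries_on_ball g (fun n => (moment mu n)%:C) 0 1.
Proof.
move=> [gE _] z z1; have one_le (w : R[i]) : unit_disc w -> absC (1 : R[i]) <= 1.
  by rewrite absC1.
have [|_ ->] := gE z; first by move: z1; rewrite subr0.
refine (csum_to_ext (pseries_cauchy_transform pseries_one one_le z1) _) => n.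
congr (_ * _); rewrite -cintegral_pow; apply: eq_cintegral => t _.
by rewrite mulr1.
Qed.

(** The coefficients [a] of the constant 1 are given existentially, and
    uniqueness forces them to be [1, 0, 0, ...]. *)
Lemma hankel_op_one g : hankel_op mu (fun=> 1) g ->
  has_pseries_on_ball g (fun n => (moment mu n)%:C) 0 1.
Proof.
move=> [a [b [fa ab gb _]]].
have aE := pseries_unique ltr01 fa pseries_one.
rewrite (_ : (fun n => _) = b)//; apply/funext => n; apply: csum_to_unique (ab n).
have := @csum_to_finite R (fun k => (moment mu (n + k))%:C * a k) 1.
rewrite big_ord1 aE mulr1 addn0; apply => -[//|k _].
by rewrite aE mulr0.
Qed.

Lemma summable_of_bounded (T : (R[i] -> R[i]) -> (R[i] -> R[i]) -> Prop) :
  (forall g, T (fun=> 1) g ->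
    has_pseries_on_ball g (fun n => (moment mu n)%:C) 0 1) ->
  bounded_on_Hinfty T -> (\sum_(0 <= n <oo) (moment mu n)%:E < +oo)%E.
Proof.
move=> T1 [K hK]; have [g [/T1 gm Hg gK]] := hK _ Hinfty_one.
apply: (summable_moments gm) => z z1.
by rewrite (le_trans (Hinfty_norm_ge Hg z1)).
Qed.

End Operators.

Unset Implicit Arguments.
Set Strict Implicit.
Set Printing Implicit Defensive.

Theorem theorem1p2 (R : realType)
    (mu : {finite_measure set (measurableTypeR R) -> \bar R}) :
  [<-> (\int[mu]_(t in `[0%R, 1%R[) ((1 - t)^-1)%:E < +oo)%E;
       (\sum_(0 <= n <oo) (moment mu n)%:E < +oo)%E;
       bounded_on_Hinfty (integral_op mu);
       bounded_on_Hinfty (hankel_op mu)].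
Proof.
have integral_bounded : (\sum_(0 <= n <oo) (moment mu n)%:E < +oo)%E ->
    bounded_on_Hinfty (integral_op mu) /\ bounded_on_Hinfty (hankel_op mu).
  rewrite sum_moments => /integrable_kernel1/operators_bounded[K hK].
  by split; exists K => f /hK[g [? ? ? ?]]; exists g.
tfae.
- by rewrite sum_moments.
- by move=> /integral_bounded[].
- by move=> /(summable_of_bounded (@integral_op_one _ mu))/integral_bounded[].
- by rewrite -sum_moments; apply: summable_of_bounded; exact: hankel_op_one.
Qed.
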